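(* Assume that the loss function $\mathcal{L}$ is restricted $L$-smooth and satisfies the strong $\lambda$-Polyak-Łojasiewicz condition, and that the retraction error is controlled (with perturbations $\beta_t$), with constants $L$, $\lambda$ and $C_{\mathrm R}$, respectively. Assume that the estimators $P_t^n$ have bounded bias and variance with $c_{\mathrm{bias},2}=0$. Assume further that for the current step $t\ge0$ the points $x_1,\dots,x_n$ are i.i.d. samples drawn from $\mu_t$ given $\mathcal{F}_t$. Choose $\delta\in(0,\tfrac12)$ and $s_t\in\mathcal{O}(t^{\delta-1})$ as well as $\beta_t\in\mathcal{O}(t^{2\delta-2})$. Assume that $\|(I-P_t)g_t\|\in\ell^\infty$ (as a sequence in $t$) almost surely. Then for any $\epsilon\in(2\delta,1)$ it holds almost surely that $$\mathcal{L}(u_t)-\mathcal{L}_{\min,\mathcal{M}}\in\mathcal{O}(t^{-1+\epsilon}).$$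
   Context: Setting. $\mathcal{X}$ is a set with probability measure $\rho$, $\mathcal{H}$ is a Hilbert space of functions on $\mathcal{X}$ with inner product $(\cdot,\cdot)$ and norm $\|\cdot\|$, $\mathcal{L}:\mathcal{H}\to\mathbb{R}$, $\mathcal{L}(v)=\int \ell(v;x)\,d\rho(x)$ is the expected loss of a loss function $\ell:\mathcal{H}\times\mathcal{X}\to\mathbb{R}$, $\mathcal{M}\subseteq\mathcal{H}$ is a (possibly nonlinear) model class, and $\mathcal{L}_{\min,\mathcal{M}}:=\inf_{u\in\mathcal{M}}\mathcal{L}(u)$. $(\Omega,\Sigma,\mathbb{P},(\mathcal{F}_t)_{t\ge0})$ is a filtered probability space. Algorithm. Given an $\mathcal{F}_0$-measurable $u_0\in\mathcal{M}$, define for $t\ge0$ $$g_t:=\nabla\mathcal{L}(u_t),\qquad \bar u_{t+1}:=u_t-s_tP_t^ng_t,\qquad u_{t+1}:=R_t(\bar u_{t+1}).$$ Here $\mathcal{L}$ is Fréchet differentiable at $u_t$ and $\nabla\mathcal{L}(u_t)\in\mathcal{H}$ is the Riesz representative of the derivative; $\mathcal{T}_t\subseteq\mathcal{H}$ is an $\mathcal{F}_t$-measurable linear space of finite dimension $d_t$ associated with $u_t$; $P_t:\mathcal{H}\to\mathcal{T}_t$ is the $\mathcal{H}$-orthogonal projection; $P_t^n$ is a random operator with values in $\mathcal{T}_t$ (an estimator of $P_t$), built from the $n$ sample points $x_1,\dots,x_n$ drawn at step $t$ conditionally on $\mathcal{F}_t$ from an $\mathcal{F}_t$-dependent probability measure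 $\mu_t$ on $\mathcal{X}$, so that $u_{t+1}$ is $\mathcal{F}_{t+1}$-measurable; $s_t>0$ is the step size ($\mathcal{F}_t$-measurable); the retraction $R_t:\mathcal{H}\to\mathcal{M}$ is $\mathcal{F}_t$-measurable. The symbol $\mathcal{O}$ denotes an upper bound up to a constant. Restricted $L$-smoothness: $L>0$ and for all $u_t\in\mathcal{M}$ with associated $\mathcal{T}_t$ and all $g\in\mathcal{T}_t$, $\mathcal{L}(u_t+g)\le\mathcal{L}(u_t)+(\nabla\mathcal{L}(u_t),g)+\frac L2\|g\|^2$. Strong $\lambda$-Polyak-Łojasiewicz condition: $\lambda>0$ and for all $u_t\in\mathcal{M}$ with associated $\mathcal{T}_t$, $\|P_t\nabla\mathcal{L}(u_t)\|^2\ge2\lambda(\mathcal{L}(u_t)-\mathcal{L}_{\min,\mathcal{M}})$. Controlled retraction error with $C_{\mathrm R}>0$ and $\beta_t\ge0$: for all $t$ and $g\in\mathcal{T}_t$, $\mathcal{L}(R_t(u_t+g))\le\mathcal{L}(u_t+g)+\frac{C_{\mathrm R}}2\|g\|^2+\beta_t$. Bounded bias and variance (case $c_{\mathrm{bias},2}=0$): $c_{\mathrm{bias},1},c_{\mathrm{var},1},c_{\mathrm{var},2}$ are positive constants and, for every $t$ and every ($\mathcal{F}_t$-measurable) $g\in\mathcal{H}$, $\mathbb{E}[(g,P_t^ng)\mid\mathcal{F}_t]\ge c_{\mathrm{bias},1}\|P_tg\|^2$ and $\mathbb{E}[\|P_t^ng\|^2\mid\mathcal{F}_t]\le c_{\m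athrm{var},1}\|P_tg\|^2+c_{\mathrm{var},2}\|(I-P_t)g\|^2$.
   Formalization: The step size is assumed of exact order t^{δ-1}: besides s_t ∈ O(t^{δ-1}), also t^{δ-1} ∈ O(s_t) almost surely; with the upper bound alone the claim fails, e.g. for s_t = 4^{-t-1} and L(v) = v²/2 on the real line. *)

(* Defs.v *)
From HB Require Import structures.
From mathcomp Require Import all_boot all_order all_algebra.
From mathcomp Require Import all_classical all_reals all_analysis.
From mathcomp Require Import measurable_realfun.
Set Implicit Arguments.
Unset Strict Implicit.
Unset Printing Implicit Defensive.
Import Order.TTheory GRing.Theory Num.Theory.
Import numFieldNormedType.Exports.
Local Open Scope classical_set_scope.
Local Open Scope ring_scope.

(* A real Hilbert space is a complete normed space whose norm is induced by an
   inner product [dot]. *)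
Definition inner_product (R : realType) (H : completeNormedModType R)
    (dot : H -> H -> R) : Prop :=
  [/\ forall x y, dot x y = dot y x,
      forall a x y z, dot (a *: x + y) z = a * dot x z + dot y z
    & forall x, `|x| ^+ 2 = dot x x].

Definition has_dim (R : realType) (H : completeNormedModType R)
    (V : set H) (k : nat) : Prop :=
  exists b : 'I_k -> H,
    (forall c : 'I_k -> R,
        \sum_(i < k) c i *: b i = 0 -> forall i, c i = 0) /\
    V = range (fun c : 'I_k -> R => \sum_(i < k) c i *: b i).

Definition orth_proj (R : realType) (H : completeNormedModType R)
    (dot : H -> H -> R) (V : set H) (p : H -> H) : Prop :=
  forall h, V (p h) /\ forall v, V v -> dot (h - p h) v = 0.

Definition riesz_gradient (R : realType) (H : completeNormedModType R)
    (dot : H -> H -> R) (f : H -> R) (v g : H) : Prop :=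
  differentiable (f : H -> R^o) v /\
  forall h, 'd (f : H -> R^o) v h = dot g h.

Definition borel (R : realType) (H : completeNormedModType R) :=
  g_sigma_algebraType (@open H).

Definition filtration d (Omega : measurableType d) (F : nat -> set (set Omega))
    : Prop :=
  [/\ forall t, sigma_algebra setT (F t),
      forall t, F t `<=` measurable
    & forall t, F t `<=` F t.+1].

Definition sub_measurable d dS (Omega : measurableType d)
    (G : set (set Omega)) (S : measurableType dS) (f : Omega -> S) : Prop :=
  measurable_fun setT (f : g_sigma_algebraType G -> S).

Definition cond_exp_ge0 d (Omega : measurableType d) (R : realType)
    (Pr : probability Omega R) (G : set (set Omega))
    (f e : Omega -> \bar R) : Prop :=
  [/\ forall w, (0 <= e w)%E,
      sub_measurable G e
    & forall A, G A -> (\int[Pr]_(w in A) e w = \int[Pr]_(w in A) f w)%E].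

(* [e] is a version of E[f | G] := E[f^+ | G] - E[f^- | G]. As for the integral
   itself, this only asks that the difference makes sense pointwise ([+?]
   excludes oo - oo), so [f] need not be integrable; for an integrable [f] it is
   the usual conditional expectation. *)
Definition cond_exp d (Omega : measurableType d) (R : realType)
    (Pr : probability Omega R) (G : set (set Omega))
    (f : Omega -> R) (e : Omega -> \bar R) : Prop :=
  measurable_fun setT f /\
  exists ep en : Omega -> \bar R,
    [/\ cond_exp_ge0 Pr G (EFin \o f)^\+%E ep,
        cond_exp_ge0 Pr G (EFin \o f)^\-%E en
      & forall w, (ep w +? - en w)%E /\ e w = (ep w - en w)%E].

(* Conditionally on [G], the coordinates of [xs] are independent with common
   law [mu]: P(x_1 \in A_1, ..., x_n \in A_n | G) = \prod_i mu(A_i). *)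
Definition cond_iid d dX (Omega : measurableType d) (X : measurableType dX)
    (R : realType) (Pr : probability Omega R) (G : set (set Omega)) (n : nat)
    (xs : Omega -> n.-tuple X) (mu : R.-pker (g_sigma_algebraType G) ~> X)
    : Prop :=
  forall A : 'I_n -> set X, (forall i, measurable (A i)) ->
    cond_exp Pr G (\1_[set w | forall i, A i (tnth (xs w) i)])
      (fun w => (\prod_(i < n) mu w (A i))%E).

(* [assoc v V] reads "V is a linear space associated with the point v". It is a
   relation, since the space used at v may also depend on the step and on the
   randomness. *)
Definition restricted_smooth (R : realType) (H : completeNormedModType R)
    (dot : H -> H -> R) (M : set H) (assoc : H -> set H -> Prop)
    (Loss : H -> R) (grad : H -> H) (Lc : R) : Prop :=
  forall v V, M v -> assoc v V -> forall g, V g ->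
    Loss (v + g) <= Loss v + dot (grad v) g + Lc / 2 * `|g| ^+ 2.

Definition strong_PL (R : realType) (H : completeNormedModType R)
    (dot : H -> H -> R) (M : set H) (assoc : H -> set H -> Prop)
    (Loss : H -> R) (grad : H -> H) (lambda : R) : Prop :=
  forall v V p, M v -> assoc v V -> orth_proj dot V p ->
    `|p (grad v)| ^+ 2 >= 2 * lambda * (Loss v - inf (Loss @` M)).

Definition controlled_retraction (R : realType) (H : completeNormedModType R)
    (Omega : Type) (Loss : H -> R) (u : nat -> Omega -> H)
    (T : nat -> Omega -> set H) (Ret : nat -> Omega -> H -> H)
    (C_R : R) (beta : nat -> R) : Prop :=
  forall t w g, T t w g ->
    Loss (Ret t w (u t w + g))
      <= Loss (u t w + g) + C_R / 2 * `|g| ^+ 2 + beta t.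

Definition bounded_bias d (Omega : measurableType d) (R : realType)
    (H : completeNormedModType R) (dot : H -> H -> R)
    (Pr : probability Omega R) (F : nat -> set (set Omega))
    (P Pn : nat -> Omega -> H -> H) (c_bias1 : R) : Prop :=
  forall t (g : Omega -> borel H), sub_measurable (F t) g ->
    exists e, cond_exp Pr (F t) (fun w => dot (g w) (Pn t w (g w))) e /\
      {ae Pr, forall w, ((c_bias1 * `|P t w (g w)| ^+ 2)%:E <= e w)%E}.

Definition bounded_variance d (Omega : measurableType d) (R : realType)
    (H : completeNormedModType R)
    (Pr : probability Omega R) (F : nat -> set (set Omega))
    (P Pn : nat -> Omega -> H -> H) (c_var1 c_var2 : R) : Prop :=
  forall t (g : Omega -> borel H), sub_measurable (F t) g ->
    exists e, cond_exp Pr (F t) (fun w => `|Pn t w (g w)| ^+ 2) e /\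
      {ae Pr, forall w,
        (e w <= (c_var1 * `|P t w (g w)| ^+ 2
                 + c_var2 * `|(g w : H) - P t w (g w)| ^+ 2)%:E)%E}.

(* Main.v *)
Require Import Defs.
From HB Require Import structures.
From mathcomp Require Import all_boot all_order all_algebra.
From mathcomp Require Import all_classical all_reals all_analysis.
From mathcomp Require Import measurable_realfun.
From mathcomp Require Import ring lra.
Set Implicit Arguments.
Unset Strict Implicit.
Unset Printing Implicit Defensive.
Import Order.TTheory GRing.Theory Num.Theory.
Import numFieldNormedType.Exports.
Local Open Scope classical_set_scope.
Local Open Scope ring_scope.

(** Put v_t = L(u_t) - L_min. Smoothness and the retraction bound turn one step
    into
      v_{t+1} <= v_t - s_t (g_t, P_t^n g_t) + K s_t^2 |P_t^n g_t|^2 + beta_t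
    with K = (L + C_R) / 2. Conditionally on F_t the bias bound makes the gain
    s_t (g_t, P_t^n g_t) at least c_bias,1 s_t |P_t g_t|^2, and the variance
    bound makes the quadratic term O(s_t^2 (|P_t g_t|^2 + |(I - P_t) g_t|^2)).
    As s_t -> 0, the part of the noise proportional to |P_t g_t|^2 is eventually at most half of
    the drift, and the Polyak-Lojasiewicz condition converts the other half into
    a contraction:
      E[v_{t+1} | F_t] <= (1 - kappa t^(delta-1)) v_t + O(t^(2 delta - 2)).
    Passing from t to t + 1 enlarges the weight t^(1-epsilon) by a factor
    1 + O(1/t), which the contraction beats since 1/t = o(t^(delta-1)). The
    weighted noise is O(t^(-1-eta)) with eta = epsilon - 2 delta > 0, which is
    dominated by the decrease of D t^(-eta) for D large. Hence
      W_t = t^(1-epsilon) v_t + D t^(-eta)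
    is a nonnegative supermartingale for large t ([drift_absorbs_noise]), and it
    only remains to know that such a process is almost surely bounded.

    The constants hidden in the asymptotic hypotheses are random and W_t need
    not be integrable, so everything is localized: the supermartingale
    inequality is only used after integration over events B of F_t on which W_t
    and the constants are bounded ([integrated_descent]), and boundedness on the
    corresponding part of the sample space follows from a maximal inequality for
    the process stopped at its first exit ([local_supermartingale_bounded]).
    Countably many such localizations cover almost every outcome. On B the
    gradient is bounded too, because a deterministic step along - P_t g_t cannot
    lead below L_min, whence |P_t g_t|^2 = O(v_t + beta_t)
    ([proj_gradient_le]). *)

(** * Measurability with respect to a sub-sigma-algebra *)

Lemma g_sigma_measurableE d (Omega : measurableType d) (G : set (set Omega)) :
  sigma_algebra setT G ->
  (measurable : set (set (g_sigma_algebraType G))) = G.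
Proof. exact: sigma_algebra_id. Qed.

Lemma sigma_algebra_setI d (Omega : measurableType d) (G : set (set Omega))
    (A B : set Omega) :
  sigma_algebra setT G -> G A -> G B -> G (A `&` B).
Proof.
move=> sG; rewrite -(g_sigma_measurableE sG); exact: measurableI.
Qed.

Lemma sub_measurable_preimage d dS (Omega : measurableType d)
    (G : set (set Omega)) (S : measurableType dS) (f : Omega -> S) (Y : set S) :
  sigma_algebra setT G -> sub_measurable G f -> measurable Y -> G (f @^-1` Y).
Proof.
move=> sG mf mY; rewrite -(g_sigma_measurableE sG) -[_ @^-1` _]setTI.
exact: mf.
Qed.

Lemma sub_measurableW d dS (Omega : measurableType d) (G : set (set Omega))
    (S : measurableType dS) (f : Omega -> S) :
  sigma_algebra setT G -> G `<=` measurable -> sub_measurable G f ->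
  measurable_fun setT f.
Proof.
move=> sG Gm mf _ Y mY; rewrite setTI.
by apply: Gm; exact: sub_measurable_preimage.
Qed.

(** The function need only be continuous at the points of [M], a set that may fail
    to be measurable: a sublevel set of [f] meets [M] in the trace of its own
    interior, which is open. *)
Lemma sub_measurable_comp_continuous d (Omega : measurableType d) (R : realType)
    (H : completeNormedModType R) (G : set (set Omega)) (M : set H)
    (f : H -> R) (u : Omega -> borel H) :
  (forall x, M x -> {for x, continuous (f : H -> R^o)}) ->
  (forall w, M (u w)) -> sub_measurable G u ->
  sub_measurable G (fun w => f (u w)).
Proof.
move=> fM uM mu.
apply: (measurability _ (RGenInftyO.measurableE R)) => //.
move=> _ [_ [c ->] <-]; rewrite setTI.
have -> : (fun w => f (u w)) @^-1` `]-oo, c[%classic =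
    u @^-1` (interior [set x : H | f x < c]).
  apply/seteqP; split => w /=; rewrite in_itv /=.
    move=> fc; apply: (fM _ (uM w) [set y : R | y < c]).
    by apply: open_nbhs_nbhs; split => //; exact: open_lt.
  by move=> /nbhs_singleton.
rewrite -[_ @^-1` _]setTI; apply: mu => //.
by apply: sub_sigma_algebra; exact: open_interior.
Qed.

Lemma sub_measurable_normsq d (Omega : measurableType d) (R : realType)
    (H : completeNormedModType R) (G : set (set Omega)) (u : Omega -> borel H) :
  sub_measurable G u -> sub_measurable G (fun w => `|u w : H| ^+ 2).
Proof.
move=> mu; apply: measurable_funX.
apply: (@sub_measurable_comp_continuous _ _ _ _ _ setT (fun x => `|x|)) mu => //.
by move=> x _; exact: norm_continuous.
Qed.

(** * Conditional expectations integrated against weights *)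

Section conditional_expectation.
Context d (Omega : measurableType d) (R : realType).
Variables (Pr : probability Omega R) (G : set (set Omega)).
Hypotheses (sG : sigma_algebra setT G) (Gm : G `<=` measurable).
Local Open Scope ereal_scope.
Import HBNNSimple.

(** The defining property of a conditional expectation extends from events to
    nonnegative [G]-measurable weights [h], by monotone convergence from simple
    functions. It is needed with the step size as weight: the estimator is not
    assumed linear, so the step size cannot be moved into its argument. *)
Lemma cond_exp_ge0_weight (f e : Omega -> \bar R) (h : Omega -> R)
    (A : set Omega) :
  (forall w, 0 <= f w) -> measurable_fun setT f ->
  cond_exp_ge0 Pr G f e -> (forall w, (0 <= h w)%R) -> sub_measurable G h ->
  G A ->
  \int[Pr]_(w in A) ((h w)%:E * e w) = \int[Pr]_(w in A) ((h w)%:E * f w).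
Proof.
move=> f0 mf [e0 me intef] h0 mh GA.
have mA := Gm GA.
have me' : measurable_fun setT e by exact: sub_measurableW me.
have mhE : measurable_fun setT
    (EFin \o h : g_sigma_algebraType G -> \bar R) by exact/measurable_EFinP.
pose k := nnsfun_approx measurableT mhE.
have k_cvg w : (EFin \o (fun n => k n w)) n @[n --> \oo] --> (h w)%:E.
  by apply: cvg_nnsfun_approx => // ? _; rewrite lee_fin.
have k_nd w : nondecreasing_seq (fun n => (k n w)%:E).
  move=> a b ab; rewrite lee_fin.
  by have /lefP := nd_nnsfun_approx measurableT mhE ab; exact.
have mk n : measurable_fun setT (k n : Omega -> R).
  by apply: (@sub_measurableW _ _ _ G) => //; exact: measurable_funP.
have mlim (g : Omega -> \bar R) : (forall w, 0 <= g w) ->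
    measurable_fun setT g -> \int[Pr]_(w in A) ((h w)%:E * g w) =
    limn (fun n => \int[Pr]_(w in A) ((k n w)%:E * g w)).
  move=> g0 mg.
  have -> : \int[Pr]_(w in A) ((h w)%:E * g w) =
      \int[Pr]_(w in A) (limn (fun n => (k n w)%:E * g w)).
    apply: eq_integral => w _; apply/esym/cvg_lim => //.
    (* [0 * +oo] is discontinuous: where [h] vanishes so do its approximants *)
    have [hw0|hw0] := eqVneq (h w) 0%R; last first.
      apply: cvgeM (k_cvg w) (cvg_cst _); 
      case: (g w) (g0 w) => [r|_|//]; first by rewrite mule_def_fin.
      by rewrite mule_def_neq0_infty // eqe.
    have k0 n : k n w = 0%R.
      apply/eqP; rewrite eq_le fun_ge0 andbT -hw0 -lee_fin.
      rewrite -(cvg_unique _ (ereal_nondecreasing_cvgn (k_nd w)) (k_cvg w)) //.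
      by apply: ereal_sup_ubound; exists n.
    by under eq_fun do rewrite k0 mul0e; rewrite hw0 mul0e; exact: cvg_cst.
  apply: monotone_convergence => //.
  - move=> n; apply: emeasurable_funM; apply: measurable_funTS => //.
    exact/measurable_EFinP.
  - by move=> n w _; rewrite mule_ge0 ?lee_fin.
  - move=> w _ a b ab; rewrite lee_wpmul2r //; exact: k_nd.
suff intk n : \int[Pr]_(w in A) ((k n w)%:E * e w) =
    \int[Pr]_(w in A) ((k n w)%:E * f w).
  rewrite !mlim //; congr (limn _); apply/funext => n; exact: intk.
have Gk y : G (k n @^-1` [set y]).
  apply: (@sub_measurable_preimage _ _ _ G) => //.
  exact: measurable_funP.
have simple (g : Omega -> \bar R) : (forall w, 0 <= g w) ->
    measurable_fun setT g -> \int[Pr]_(w in A) ((k n w)%:E * g w) =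
    \sum_(y \in range (k n)) (y%:E *
      \int[Pr]_(w in A `&` (k n @^-1` [set y])) g w).
  move=> g0 mg.
  transitivity (\int[Pr]_(w in A) (\sum_(y \in range (k n))
      (y * \1_(k n @^-1` [set y]) w)%:E * g w)).
    apply: eq_integral => w _; rewrite {1}fimfunE -fsumEFin //.
    rewrite ge0_mule_fsuml // => y.
    exact: nnfun_muleindic_ge0.
  rewrite ge0_integral_fsum //.
  - apply: eq_fsbigr => y /[!inE] -[v _ <-].
    rewrite integral_mkcondr -ge0_integralZl_EFin //.
    + apply: eq_integral => w _; rewrite epatch_indic /= EFinM -muleA.
      by rewrite [X in _ * X = _]muleC.
    + by move=> w _; exact: erestrict_ge0.
    + apply: measurable_funTS; apply/(measurable_restrictT _ (Gm (Gk _))).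
      exact: measurable_funTS.
  - move=> y; apply: emeasurable_funM; last exact: measurable_funTS.
    apply/measurable_EFinP; apply: measurable_funM => //.
    by apply: measurable_indic; exact: Gm.
  - by move=> y w _; rewrite mule_ge0 //; exact: nnfun_muleindic_ge0.

rewrite !simple //; apply: eq_fsbigr => y _; rewrite intef //.
exact: sigma_algebra_setI.
Qed.

Lemma measurable_weight (h : Omega -> R) (g : Omega -> \bar R) (A : set Omega) :
  sub_measurable G h -> sub_measurable G g ->
  measurable_fun A (fun w => (h w)%:E * g w).
Proof.
move=> mh mg; apply: measurable_funTS; apply: emeasurable_funM.
  by apply/measurable_EFinP; exact: sub_measurableW mh.
exact: sub_measurableW mg.
Qed.

Lemma EFin_funepos (f : Omega -> R) :
  (EFin \o f)^\+ = EFin \o (fun w => Num.max (f w) 0%R).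
Proof. by apply/funext => w; rewrite funeposE /= EFin_max. Qed.

Lemma EFin_funeneg (f : Omega -> R) :
  (EFin \o f)^\- = EFin \o (fun w => Num.max (- f w)%R 0%R).
Proof. by apply/funext => w; rewrite funenegE /= EFin_max. Qed.

(** The integral form of E[f | G] >= b, written without subtraction so that
    it holds for a non-integrable [f]. *)
Lemma cond_exp_ge_weight (f b h : Omega -> R) (e : Omega -> \bar R)
    (A : set Omega) :
  cond_exp Pr G f e -> (forall w, (0 <= b w)%R) -> sub_measurable G b ->
  {ae Pr, forall w, (b w)%:E <= e w} ->
  (forall w, (0 <= h w)%R) -> sub_measurable G h -> G A ->
  \int[Pr]_(w in A) (h w * b w)%:E +
    \int[Pr]_(w in A) (h w * Num.max (- f w) 0)%:E <=
  \int[Pr]_(w in A) (h w * Num.max (f w) 0)%:E.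
Proof.
move=> [mf [ep [en [cep cen eE]]]] b0 mb be h0 mh GA.
have mA := Gm GA.
have mfE : measurable_fun setT (EFin \o f) by exact/measurable_EFinP.
have := cond_exp_ge0_weight (funepos_ge0 _) (measurable_funepos mfE) cep h0 mh GA.
have := cond_exp_ge0_weight (funeneg_ge0 _) (measurable_funeneg mfE) cen h0 mh GA.
rewrite EFin_funepos EFin_funeneg /=.
under [X in _ = X -> _]eq_integral do rewrite -EFinM; move=> <-.
under [X in _ = X -> _]eq_integral do rewrite -EFinM; move=> <-.
have mb' : sub_measurable G (EFin \o b) by exact/measurable_EFinP.
case: cep => ep0 mep _; case: cen => en0 men _.
under eq_integral do rewrite EFinM.
rewrite -ge0_integralD //; first last.
- exact: measurable_weight.
- by move=> w _; rewrite mule_ge0 ?lee_fin.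
- exact: measurable_weight mh mb'.
- by move=> w _; rewrite mule_ge0 ?lee_fin.
apply: ae_ge0_le_integral => //.
- by move=> w _; rewrite adde_ge0 ?mule_ge0 ?lee_fin.
- apply: emeasurable_funD; last exact: measurable_weight.
  exact: measurable_weight mh mb'.
- by move=> w _; rewrite mule_ge0 ?lee_fin.
- exact: measurable_weight.
apply: filterS be => w bew _; rewrite -ge0_muleDr ?lee_fin //.
rewrite lee_wpmul2l ?lee_fin //; move: bew; have [+ ->] := eE w.
case: (ep w) (en w) (ep0 w) (en0 w) => [p| |] [q| |] //= _ _ _.
- by rewrite -EFinD !lee_fin lerBrDr.
- by move=> _; exact: leey.
Qed.

Lemma cond_exp_le_weight (f b h : Omega -> R) (e : Omega -> \bar R)
    (A : set Omega) :
  cond_exp Pr G f e -> (forall w, (0 <= f w)%R) ->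
  (forall w, (0 <= b w)%R) -> sub_measurable G b ->
  {ae Pr, forall w, e w <= (b w)%:E} ->
  (forall w, (0 <= h w)%R) -> sub_measurable G h -> G A ->
  \int[Pr]_(w in A) (h w * f w)%:E <= \int[Pr]_(w in A) (h w * b w)%:E.
Proof.
move=> [mf [ep [en [cep cen eE]]]] f0 b0 mb be h0 mh GA.
have mA := Gm GA.
have mfE : measurable_fun setT (EFin \o f) by exact/measurable_EFinP.
have := cond_exp_ge0_weight (funepos_ge0 _) (measurable_funepos mfE) cep h0 mh GA.
have := cond_exp_ge0_weight (funeneg_ge0 _) (measurable_funeneg mfE) cen h0 mh GA.
rewrite EFin_funepos EFin_funeneg /=.
rewrite [X in _ = X -> _]integral0_eq => [en_int|w _]; last first.
  by rewrite max_r ?mule0 // oppr_le0.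
under [X in _ = X -> _]eq_integral do rewrite max_l // -EFinM; move=> <-.
have mb' : sub_measurable G (EFin \o b) by exact/measurable_EFinP.
case: cep => ep0 mep _; case: cen => en0 men _.
under [leRHS]eq_integral do rewrite EFinM.
rewrite -[leRHS]adde0 -en_int -ge0_integralD //; first last.
- exact: measurable_weight.
- by move=> w _; rewrite mule_ge0 ?lee_fin.
- exact: measurable_weight mh mb'.
- by move=> w _; rewrite mule_ge0 ?lee_fin.
apply: ae_ge0_le_integral => //.
- by move=> w _; rewrite mule_ge0 ?lee_fin.
- exact: measurable_weight.
- by move=> w _; rewrite adde_ge0 ?mule_ge0 ?lee_fin.
- apply: emeasurable_funD; last exact: measurable_weight.
  exact: measurable_weight mh mb'.
apply: filterS be => w bew _; rewrite -ge0_muleDr ?lee_fin //.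
rewrite lee_wpmul2l ?lee_fin //; move: bew; have [+ ->] := eE w.
case: (ep w) (en w) (ep0 w) (en0 w) => [p| |] [q| |] //= _ _ _.
- by rewrite -EFinD !lee_fin lerBlDr.
- by move=> _; exact: leey.
Qed.

End conditional_expectation.

(** * Local supermartingales *)

Section local_supermartingale.
Context d (Omega : measurableType d) (R : realType) (Pr : probability Omega R).
Variables (F : nat -> set (set Omega)) (hF : filtration F).
Variables (W : nat -> Omega -> R) (A : nat -> set Omega).
Hypothesis W0 : forall k w, 0 <= W k w.
Hypothesis mW : forall k, sub_measurable (F k) (W k).
Hypothesis FA : forall k, F k (A k).
Hypothesis W_step : forall k B (m : R), F k B -> B `<=` A k ->
  (forall w, B w -> W k w <= m) ->
  (\int[Pr]_(w in B) (W k.+1 w)%:E <= \int[Pr]_(w in B) (W k w)%:E)%E.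

Let sF k : sigma_algebra setT (F k). Proof. by case: hF. Qed.
Let FM k : F k `<=` measurable. Proof. by case: hF. Qed.
Let Fle k : F k `<=` F k.+1. Proof. by case: hF => _ _; exact. Qed.

(** [confined] and [escaped] describe the process stopped at its first exit by
    events instead of a stopping time: [confined c m k] is the part of the sample
    space where no exit occurred up to time [k], [escaped c m k] the part where
    the process crossed the level [m] by time [k] before leaving the sets [A]. *)
Fixpoint confined (c m : R) (k : nat) : set Omega :=
  if k is k'.+1 then
    confined c m k' `&` (A k `&` [set w | W k w <= m])
  else A 0%N `&` [set w | W 0%N w <= c].

Fixpoint escaped (c m : R) (k : nat) : set Omega :=
  if k is k'.+1 then
    escaped c m k' `|` (confined c m k' `&` [set w | m < W k w])
  else set0.

Let F_le k (m : R) : F k [set w | W k w <= m].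
Proof.
have -> : [set w | W k w <= m] = W k @^-1` `]-oo, m].
  by apply/seteqP; split => w /=; rewrite in_itv.
exact: sub_measurable_preimage.
Qed.

Let F_gt k (m : R) : F k [set w | m < W k w].
Proof.
have -> : [set w | m < W k w] = W k @^-1` `]m, +oo[.
  by apply/seteqP; split => w /=; rewrite in_itv /= andbT.
exact: sub_measurable_preimage.
Qed.

Lemma F_confined c m k : F k (confined c m k).
Proof.
elim: k => [|k IH] /=; first exact: sigma_algebra_setI.
apply: sigma_algebra_setI => //; first exact: Fle.
exact: sigma_algebra_setI.
Qed.

Lemma measurable_escaped c m k : measurable (escaped c m k).
Proof.
elim: k => [|k IH] //=; apply: measurableU => //.
apply: measurableI; first exact: FM (@F_confined _ _ _).
exact: FM (@F_gt _ _).
Qed.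

Lemma confined_bound c m k w : c <= m -> confined c m k w ->
  A k w /\ W k w <= m.
Proof.
by move=> cm; case: k => [|k] /= [? ?]; [split=> //; exact: le_trans cm | tauto].
Qed.

(** Doob's maximal inequality: on the confined event the mean of [W] does not
    increase, and mass that crosses the level [m] contributes at least [m] per
    unit of probability. *)
Lemma maximal_inequality c m k : 0 <= c -> c <= m ->
  (m%:E * Pr (escaped c m k) + \int[Pr]_(w in confined c m k) (W k w)%:E
     <= c%:E)%E.
Proof.
move=> c0 cm; have m0 := le_trans c0 cm.
have mWT j : measurable_fun setT (EFin \o W j).
  by apply/measurable_EFinP; exact: sub_measurableW (sF j) (@FM j) (@mW j).
elim: k => [|k IH] /=.
  rewrite measure0 mule0 add0e.
  set B := _ `&` _.
  have mB : measurable B by exact: FM (@F_confined c m 0).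
  apply: (@le_trans _ _ (\int[Pr]_(w in B) c%:E)%E).
    apply: ge0_le_integral => //.
    - by move=> w _; rewrite lee_fin.
    - exact: measurable_funTS (mWT _).
    - by move=> w [_ /= ?]; rewrite lee_fin.
  by rewrite integral_cst // -[leRHS]mule1 lee_wpmul2l ?lee_fin ?probability_le1.
set B := confined c m k; set B' := _ `&` (_ `&` _).
set X := _ `&` [set w | m < _].
have mB : measurable B by exact: FM (@F_confined _ _ _).
have mB' : measurable B' by exact: FM (@F_confined c m k.+1).
have mX : measurable X by apply: measurableI => //; exact: FM (@F_gt _ _).
apply: le_trans IH.
apply: (@le_trans _ _ (m%:E * Pr (escaped c m k) +
  \int[Pr]_(w in B) (W k.+1 w)%:E)%E); last first.
  rewrite leeD2l //; apply: (W_step (m := m)); first exact: F_confined.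
    by move=> w /(confined_bound cm)[].
  by move=> w /(confined_bound cm)[].
apply: (@le_trans _ _ (m%:E * Pr (escaped c m k) + (m%:E * Pr X +
  \int[Pr]_(w in B') (W k.+1 w)%:E))%E).
  rewrite [leRHS]addeA -ge0_muleDr // leeD2r // lee_wpmul2l ?lee_fin //.
  by apply: measureU2 => //; exact: measurable_escaped.
rewrite leeD2l //.
apply: (@le_trans _ _ (\int[Pr]_(w in X `|` B') (W k.+1 w)%:E)%E).
  rewrite ge0_integral_setU //; first last.
  - rewrite disj_set2E; apply/eqP; apply/seteqP; split => // w.
    by rewrite /X /B' => -[[? lt1] [? [? le1]]]; move: lt1; rewrite /= ltNge le1.
  - by move=> w _; rewrite lee_fin.
  - exact: measurable_funTS (mWT _).
  rewrite leeD2r // -integral_cst //; apply: ge0_le_integral => //.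
  - exact: measurable_funTS (mWT _).
  - by move=> w [_ /= /ltW]; rewrite lee_fin.
apply: ge0_subset_integral => //; first exact: measurableU.
- exact: measurable_funTS (mWT _).
- by move=> w _; rewrite lee_fin.
- by move=> w [[]|[]].
Qed.

Lemma prob_escaped c m : 0 <= c -> c <= m ->
  (m%:E * Pr (\bigcup_k escaped c m k) <= c%:E)%E.
Proof.
move=> c0 cm.
have mU : measurable (\bigcup_k escaped c m k).
  by apply: bigcup_measurable => k _; exact: measurable_escaped.
have nd : nondecreasing_seq (escaped c m).
  by apply/nondecreasing_seqP => k; apply/subsetPset => w /=; left.
have cv := nondecreasing_cvg_mu (measurable_escaped c m) mU nd (mu := Pr).
have cv' := cvgeZl (y := m%:E) isT cv.
rewrite -(cvg_lim _ cv') //; apply: lime_le.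
  by apply/cvg_ex; eexists; exact: cv'.
near=> k; apply: le_trans (maximal_inequality k c0 cm).
by rewrite leeDl // integral_ge0 // => w _; rewrite lee_fin.
Unshelve. all: by end_near. Qed.

Lemma bounded_or_escaped c m w : c <= m -> (forall k, A k w) -> W 0%N w <= c ->
  (forall k, W k w <= m) \/ (\bigcup_k escaped c m k) w.
Proof.
move=> cm Aw W0c; have [|nesc] := pselect ((\bigcup_k escaped c m k) w).
  by right.
left; have conf k : confined c m k w.
  elim: k => [|k IH] //=; split=> //; split => //=.
  by rewrite leNgt; apply/negP => mlt; apply: nesc; exists k.+1 => //=; right.
by move=> k; have [] := confined_bound cm (conf k).
Qed.

(** Starting below [c], the process crosses a level [m] with probability at most
    [c / m]; hence almost surely it crosses only finitely many levels. Letting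
    [c] run through the naturals avoids any integrability of [W 0]. *)
Lemma local_supermartingale_bounded :
  {ae Pr, forall w, (forall k, A k w) -> exists m, forall k, W k w <= m}.
Proof.
suff : {ae Pr, forall w, forall j : nat, (forall k, A k w) -> W 0%N w <= j%:R ->
    exists m, forall k, W k w <= m}.
  apply: filterS => w Hw Aw.
  by apply: (Hw (Num.truncn (W 0%N w)).+1) => //; exact/ltW/truncnS_gt.
apply: ae_foralln => j.
have mE i : measurable (\bigcup_k escaped j%:R (j + i)%:R k).
  by apply: bigcup_measurable => k _; exact: measurable_escaped.
exists (\bigcap_i \bigcup_k escaped j%:R (j + i)%:R k); split.
- apply: bigcap_measurable; first by exists 0%N.
  by move=> i _; exact: mE.
- set N := \bigcap_i _.
  have mN : measurable N.
    by apply: bigcap_measurable; [exists 0%N | move=> i _; exact: mE].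
  have fN : Pr N \is a fin_num by exact: fin_num_measure.
  apply/eqP; rewrite eq_le measure_ge0 andbT leNgt; apply/negP => PN0.
  have N0 : 0 < fine (Pr N) by rewrite fine_gt0 // PN0 ltey_eq fN.
  (* a level at which [prob_escaped] contradicts [Pr N > 0] *)
  pose i := (Num.truncn (j%:R / fine (Pr N))).+1.
  have : ((j + i)%:R%:E * Pr N <= j%:R%:E)%E.
    apply: le_trans (@prob_escaped j%:R (j + i)%:R _ _) => //; last first.
      by rewrite ler_nat leq_addr.
    apply: lee_wpmul2l; first by rewrite lee_fin.
    by apply: le_measure; rewrite ?inE //; move=> w; exact.
  apply/negP; rewrite -ltNge -(fineK fN) -EFinM lte_fin.
  rewrite -ltr_pdivrMr // (lt_le_trans (truncnS_gt _)) // ler_nat /i.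
  by rewrite leq_addl.
- move=> w /= /not_implyP[Aw] /not_implyP[W0j nm] i _.
  have ji : j%:R <= (j + i)%:R :> R by rewrite ler_nat leq_addr.
  have [Wm|//] := bounded_or_escaped ji Aw W0j.
  by exfalso; apply: nm; exists (j + i)%:R.
Qed.

End local_supermartingale.

(** * Geometry of a single step *)

Section inner_product_theory.
Context (R : realType) (H : completeNormedModType R) (dot : H -> H -> R).
Hypothesis hdot : inner_product dot.

Lemma dotC x y : dot x y = dot y x. Proof. by case: hdot. Qed.

Lemma dotDl x y z : dot (x + y) z = dot x z + dot y z.
Proof. by case: hdot => _ /(_ 1 x y z); rewrite scale1r mul1r. Qed.

Lemma dotZl a x z : dot (a *: x) z = a * dot x z.
Proof.
have dot0l : dot 0 z = 0.
  by have := dotDl 0 0 z; rewrite addr0 => /eqP;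
    rewrite eq_sym -subr_eq0 addrK => /eqP.
by case: hdot => _ /(_ a x 0 z); rewrite addr0 dot0l addr0.
Qed.

Lemma dotZr a x z : dot x (a *: z) = a * dot x z.
Proof. by rewrite dotC dotZl dotC. Qed.

Lemma dotBl x y z : dot (x - y) z = dot x z - dot y z.
Proof. by rewrite dotDl -scaleN1r dotZl mulN1r. Qed.

Lemma normsqE x : `|x| ^+ 2 = dot x x. Proof. by case: hdot. Qed.

Lemma normsqD x y : `|x + y| ^+ 2 = `|x| ^+ 2 + 2 * dot x y + `|y| ^+ 2.
Proof.
by rewrite !normsqE dotDl ![dot _ (x + y)]dotC !dotDl [dot y x]dotC; ring.
Qed.

Lemma dotN_le x y : - dot x y <= `|x| ^+ 2 + `|y| ^+ 2.
Proof.
have := exprn_ge0 2 (normr_ge0 (x + y)); rewrite normsqD.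
have := exprn_ge0 2 (normr_ge0 x); have := exprn_ge0 2 (normr_ge0 y).
lra.
Qed.

Lemma has_dimZ (V : set H) k (a : R) v : has_dim V k -> V v -> V (a *: v).
Proof.
move=> [b [_ ->]] [c _ <-]; exists (fun i => a * c i) => //.
by rewrite scaler_sumr; apply: eq_bigr => i _; rewrite scalerA.
Qed.

Lemma orth_proj_dot (V : set H) p g v : orth_proj dot V p -> V v ->
  dot g v = dot (p g) v.
Proof.
by move=> hp Vv; have [_ /(_ v Vv)] := hp g; rewrite dotBl => /eqP;
  rewrite subr_eq0 => /eqP.
Qed.

Lemma orth_proj_pythagoras (V : set H) p g : orth_proj dot V p ->
  `|g| ^+ 2 = `|p g| ^+ 2 + `|g - p g| ^+ 2.
Proof.
move=> hp; have [Vp perp] := hp g.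
by rewrite -[in LHS](subrK (p g) g) (normsqD (g - p g)) (perp _ Vp); ring.
Qed.

End inner_product_theory.

Section one_step.
Context (R : realType) (H : completeNormedModType R) (dot : H -> H -> R).
Hypothesis hdot : inner_product dot.
Variables (M : set H) (assoc : H -> set H -> Prop) (Loss : H -> R)
  (grad : H -> H) (Lc C beta : R) (V : set H) (k : nat) (x : H) (Ret : H -> H).
Hypotheses (Mx : M x) (xV : assoc x V) (Vk : has_dim V k).
Hypothesis hsmooth : restricted_smooth dot M assoc Loss grad Lc.
Hypothesis hretr : forall g, V g ->
  Loss (Ret (x + g)) <= Loss (x + g) + C / 2 * `|g| ^+ 2 + beta.

Lemma descent a q : V q ->
  Loss (Ret (x - a *: q)) <=
    Loss x - a * dot (grad x) q + (Lc + C) / 2 * a ^+ 2 * `|q| ^+ 2 + beta.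
Proof.
move=> Vq; have VNq : V ((- a) *: q) by exact: has_dimZ Vk Vq.
have := hretr VNq; have := hsmooth Mx xV VNq.
rewrite (dotZr hdot) normrZ scaleNr exprMn normrN real_normK ?num_real //.
lra.
Qed.

(** A retracted step of length [1 / (Lc + C)] along minus the projected
    gradient decreases the loss by [`|p (grad x)| ^+ 2 / (2 * (Lc + C))], up to
    [beta], and ends in [M], where the loss is at least its infimum. *)
Lemma proj_gradient_le p : orth_proj dot V p -> 0 < Lc + C ->
  has_lbound (Loss @` M) -> (forall h, M (Ret h)) ->
  `|p (grad x)| ^+ 2 <= 2 * (Lc + C) * (Loss x - inf (Loss @` M) + beta).
Proof.
move=> hp K0 lbM MRet; have [Vp _] := hp (grad x).
have := descent (Lc + C)^-1 Vp.
rewrite (orth_proj_dot hdot (grad x) hp Vp) -normsqE //.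
set P2 := `|p _| ^+ 2.
have lb : inf (Loss @` M) <= Loss (Ret (x - (Lc + C)^-1 *: p (grad x))).
  by apply: ge_inf => //; exists (Ret (x - (Lc + C)^-1 *: p (grad x))).
move=> /(le_trans lb).
have -> : (Lc + C) / 2 * (Lc + C)^-1 ^+ 2 * P2 = (Lc + C)^-1 * P2 / 2.
  by field; rewrite gt_eqF.
move=> le1.
have : (Lc + C)^-1 * P2 <= 2 * (Loss x - inf (Loss @` M) + beta) by lra.
by rewrite ler_pdivrMl // mulrCA mulrA.
Qed.

End one_step.

(** * Integrated descent *)

Section integrated_descent.
Context d (Omega : measurableType d) (R : realType).
Variables (Pr : probability Omega R) (G : set (set Omega)).
Hypotheses (sG : sigma_algebra setT G) (Gm : G `<=` measurable).

(** One step of the method, integrated over a [G]-measurable event [B]. Here [X]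
    stands for the inner product of the gradient with its estimate, [Y] for the
    squared norm of the estimate, [p] and [q] for the squared norms of the two
    components of the gradient; [U] is any function such that the conditional
    bound on [v'] is at most [U]. Positive and negative parts of [X] are kept on
    opposite sides, so that all integrals are of nonnegative functions, and are
    cancelled only once known to be finite. *)
Lemma integrated_descent (v v' X Y s p q U : Omega -> R)
    (eX eY : Omega -> \bar R) (c K c1 c2 beta m : R) (B : set Omega) :
  (forall w, 0 <= v w) -> (forall w, 0 <= v' w) -> (forall w, 0 <= Y w) ->
  (forall w, 0 <= s w) -> (forall w, 0 <= p w) -> (forall w, 0 <= q w) ->
  (forall w, B w -> 0 <= U w) ->
  0 <= c -> 0 <= K -> 0 <= c1 -> 0 <= c2 -> 0 <= beta ->
  sub_measurable G v -> measurable_fun setT v' -> sub_measurable G s ->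
  sub_measurable G p -> sub_measurable G q -> measurable_fun setT U ->
  cond_exp Pr G X eX -> {ae Pr, forall w, ((c * p w)%:E <= eX w)%E} ->
  cond_exp Pr G Y eY -> {ae Pr, forall w, (eY w <= (c1 * p w + c2 * q w)%:E)%E} ->
  (forall w, v' w <= v w - s w * X w + K * (s w) ^+ 2 * Y w + beta) ->
  (forall w, - X w <= p w + Y w) ->
  G B -> (forall w, B w -> [/\ s w <= m, p w <= m & q w <= m]) ->
  (forall w, B w ->
     v w + K * (s w) ^+ 2 * (c1 * p w + c2 * q w) + beta
       <= c * s w * p w + U w) ->
  (\int[Pr]_(w in B) (v' w)%:E <= \int[Pr]_(w in B) (U w)%:E)%E.
Proof.
move=> v0 v'0 Y0 s0 p0 q0 U0 c0 K0 c10 c20 beta0 mv mv' ms mp mq mU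
  cX leX cY leY hdesc hX GB Bm hU.
have mB := Gm GB.
have Mg (g : Omega -> R) : sub_measurable G g -> measurable_fun setT g.
  exact: sub_measurableW.
have mE (g : Omega -> R) : measurable_fun setT g ->
    measurable_fun B (fun w => (g w)%:E).
  by move=> mg; apply: measurable_funTS; exact/measurable_EFinP.
have [mX mY] : measurable_fun setT X /\ measurable_fun setT Y.
  by case: cX cY => ? _ [].
pose b w := c1 * p w + c2 * q w.
have b0 w : 0 <= b w by rewrite addr_ge0 // mulr_ge0.
have mb : sub_measurable G b.
  by apply: measurable_funD; apply: measurable_funM.
have mcp : sub_measurable G (fun w => c * p w) by exact: measurable_funM.
have ms2 : sub_measurable G (fun w => s w ^+ 2) by exact: measurable_funX.
have intX := cond_exp_ge_weight sG Gm cX (fun w => mulr_ge0 c0 (p0 w)) mcp leX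
  s0 ms GB.
have intY := cond_exp_le_weight sG Gm cY Y0 b0 mb leY s0 ms GB.
have intY2 := cond_exp_le_weight sG Gm cY Y0 b0 mb leY
  (fun w => sqr_ge0 (s w)) ms2 GB.
pose Xp w := s w * Num.max (X w) 0; pose Xn w := s w * Num.max (- X w) 0.
have Xp0 w : 0 <= Xp w by rewrite mulr_ge0 // le_max lexx orbT.
have Xn0 w : 0 <= Xn w by rewrite mulr_ge0 // le_max lexx orbT.
have mXp : measurable_fun setT Xp.
  by apply: measurable_funM; [exact: Mg | exact: measurable_maxr].
have mXn : measurable_fun setT Xn.
  apply: measurable_funM; first exact: Mg.
  by apply: measurable_maxr => //; exact: measurableT_comp.
have fin (g : Omega -> R) (r : R) : measurable_fun setT g ->
    (forall w, B w -> 0 <= g w) -> (forall w, B w -> g w <= r) ->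
    (\int[Pr]_(w in B) (g w)%:E)%E \is a fin_num.
  move=> mg g0 gr; rewrite ge0_fin_numE; last first.
    by apply: integral_ge0 => w Bw; rewrite lee_fin g0.
  apply: (@le_lt_trans _ _ (\int[Pr]_(w in B) r%:E)%E).
    by apply: ge0_le_integral => //; exact: mE.
  by rewrite integral_cst // ltey_eq fin_numM // fin_num_measure.
have intD (g1 g2 : Omega -> R) : measurable_fun setT g1 ->
    measurable_fun setT g2 -> (forall w, B w -> 0 <= g1 w) ->
    (forall w, B w -> 0 <= g2 w) ->
    (\int[Pr]_(w in B) (g1 w + g2 w)%:E =
     \int[Pr]_(w in B) (g1 w)%:E + \int[Pr]_(w in B) (g2 w)%:E)%E.
  move=> mg1 mg2 g10 g20; under eq_integral do rewrite EFinD.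
  by rewrite ge0_integralD //; exact: mE.
have int_le (g1 g2 : Omega -> R) : measurable_fun setT g1 ->
    measurable_fun setT g2 -> (forall w, B w -> 0 <= g1 w) ->
    (forall w, B w -> g1 w <= g2 w) ->
    (\int[Pr]_(w in B) (g1 w)%:E <= \int[Pr]_(w in B) (g2 w)%:E)%E.
  by move=> mg1 mg2 g10 g12; apply: ge0_le_integral => //; exact: mE.
pose sp w := s w * (c * p w); pose sb w := s w * b w.
pose sY w := s w * Y w; pose s2Y w := s w ^+ 2 * Y w.
pose s2b w := s w ^+ 2 * b w; pose vb w := v w + beta.
have {}intX : (\int[Pr]_(w in B) (sp w)%:E + \int[Pr]_(w in B) (Xn w)%:E <=
  \int[Pr]_(w in B) (Xp w)%:E)%E by exact: intX.
have {}intY : (\int[Pr]_(w in B) (sY w)%:E <= \int[Pr]_(w in B) (sb w)%:E)%E.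
  exact: intY.
have {}intY2 : (\int[Pr]_(w in B) (s2Y w)%:E <=
  \int[Pr]_(w in B) (s2b w)%:E)%E by exact: intY2.
have msp : measurable_fun setT sp by apply: measurable_funM; exact: Mg.
have msb : measurable_fun setT sb by apply: measurable_funM; exact: Mg.
have msY : measurable_fun setT sY by apply: measurable_funM => //; exact: Mg.
have ms2Y : measurable_fun setT s2Y by apply: measurable_funM => //; exact: Mg.
have ms2b : measurable_fun setT s2b by apply: measurable_funM; exact: Mg.
have mvb : measurable_fun setT vb by apply: measurable_funD => //; exact: Mg.
have Kint (g : Omega -> R) : measurable_fun setT g -> (forall w, 0 <= g w) ->
    (\int[Pr]_(w in B) (K * g w)%:E = K%:E * \int[Pr]_(w in B) (g w)%:E)%E.
  move=> mg g0; under eq_integral do rewrite EFinM.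
  by rewrite ge0_integralZl_EFin //; do ?exact: mE; move=> w _; rewrite lee_fin.
have sp0 w : 0 <= sp w by rewrite !mulr_ge0.
have sb0 w : 0 <= sb w by rewrite mulr_ge0.
have sY0 w : 0 <= sY w by rewrite mulr_ge0.
have s2Y0 w : 0 <= s2Y w by rewrite mulr_ge0 // sqr_ge0.
have s2b0 w : 0 <= s2b w by rewrite mulr_ge0 // sqr_ge0.
have vb0 w : 0 <= vb w by rewrite addr_ge0.
have fin_sp : (\int[Pr]_(w in B) (sp w)%:E)%E \is a fin_num.
  apply: (fin _ (m * (c * m))) => // w /Bm[sm pm _].
  by rewrite ler_pM ?mulr_ge0 // ler_wpM2l.
(* The negative part of [X] is dominated by integrable functions, so that its
   integral may be cancelled below. *)
have fin_Xn : (\int[Pr]_(w in B) (Xn w)%:E)%E \is a fin_num.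
  have fin_pb : (\int[Pr]_(w in B) (s w * p w + sb w)%:E)%E \is a fin_num.
    apply: (fin _ (m * m + m * (c1 * m + c2 * m))) => [|w _|w /Bm[sm pm qm]].
    - by apply: measurable_funD => //; apply: measurable_funM; exact: Mg.
    - by rewrite addr_ge0 // mulr_ge0.
    - by rewrite lerD // ler_pM // lerD // ler_wpM2l.
  rewrite ge0_fin_numE; last by apply: integral_ge0 => w _; rewrite lee_fin.
  have : (\int[Pr]_(w in B) (s w * p w + sb w)%:E < +oo)%E by rewrite ltey_eq fin_pb.
  apply: le_lt_trans.
  have msps : measurable_fun setT (fun w => s w * p w).
    by apply: measurable_funM; exact: Mg.
  have spp0 w : 0 <= s w * p w by rewrite mulr_ge0.
  rewrite intD //; apply: (le_trans _ (leeD2l _ intY)).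
  rewrite -intD //; apply: int_le => //; first exact: measurable_funD.
  by move=> w _; rewrite /Xn -mulrDr ler_wpM2l // ge_max hX addr_ge0.
have step : (\int[Pr]_(w in B) (v' w)%:E + \int[Pr]_(w in B) (Xp w)%:E <=
    \int[Pr]_(w in B) (vb w)%:E + (\int[Pr]_(w in B) (Xn w)%:E +
      K%:E * \int[Pr]_(w in B) (s2Y w)%:E))%E.
  have mKY : measurable_fun setT (fun w => K * s2Y w) by exact: measurable_funM.
  have KY0 w : 0 <= K * s2Y w by rewrite mulr_ge0.
  rewrite -Kint // -!intD //; first last.
  - by move=> w _; rewrite addr_ge0.
  - exact: measurable_funD.
  apply: int_le.
  - exact: measurable_funD.
  - by apply: measurable_funD => //; exact: measurable_funD.
  - by move=> w _; rewrite addr_ge0.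
  - move=> w _; have := hdesc w.
    have -> : s w * X w = Xp w - Xn w.
      by rewrite /Xp /Xn -mulrBr; congr (_ * _); case: (leP (X w) 0) => ?;
        case: (leP (- X w) 0) => ?; lra.
    by rewrite /vb /s2Y; lra.
have cancel (x y z : \bar R) : x \is a fin_num -> (x + y <= x + z -> y <= z)%E.
  by move=> xfin; rewrite leeD2lE.
apply: (cancel _ _ _ fin_sp); apply: (cancel _ _ _ fin_Xn).
apply: (@le_trans _ _ (\int[Pr]_(w in B) (Xn w)%:E +
  (\int[Pr]_(w in B) (vb w)%:E + K%:E * \int[Pr]_(w in B) (s2b w)%:E))%E).
  rewrite [leLHS]addeA [leLHS]addeC [X in (_ + X <= _)%E]addeC.
  apply: (le_trans (leeD2l _ intX)); apply: (le_trans step).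
  by rewrite addeCA !leeD2l // lee_wpmul2l // lee_fin.
have mKb : measurable_fun setT (fun w => K * s2b w) by exact: measurable_funM.
have Kb0 w : 0 <= K * s2b w by rewrite mulr_ge0.
rewrite leeD2l // -Kint // -!intD //.
apply: int_le.
- exact: measurable_funD.
- exact: measurable_funD.
- by move=> w _; rewrite addr_ge0.
- by move=> w /hU; rewrite /vb /s2b /sp /b; lra.
Qed.

End integrated_descent.

(** * Real powers *)

Section powers.
Context (R : realType).
Implicit Types x a : R.

Lemma powR_ge_eventually a (b : R) : 0 < a ->
  exists N, forall t, (N <= t)%N -> b <= t%:R `^ a.
Proof.
move=> a0; pose y := `|b| `^ a^-1; exists (Num.truncn y).+1 => t yt.
have yt' : y <= t%:R.
  by apply: (le_trans (ltW (truncnS_gt y))); rewrite ler_nat.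
apply: (le_trans (ler_norm b)).
have -> : `|b| = y `^ a by rewrite -powRrM mulVf ?gt_eqF // powRr1.
by apply: ge0_ler_powR => //; rewrite ?ltW // nnegrE // powR_ge0.
Qed.

Lemma powRS_le (theta x : R) : 0 <= theta <= 1 -> 1 <= x ->
  (x + 1) `^ theta <= (1 + x^-1) * x `^ theta.
Proof.
move=> /andP[t0 t1] x1; have x0 : 0 < x by lra.
have -> : x + 1 = (1 + x^-1) * x by field; rewrite gt_eqF.
rewrite powRM ?(ltW x0) //; last by rewrite addr_ge0 // invr_ge0 ltW.
rewrite ler_wpM2r ?powR_ge0 // ler1_powR //.
by rewrite lerDl invr_ge0 ltW.
Qed.

(** A discrete form of the fact that [x `^ (-1 - eta)] is the derivative of
    [- x `^ (- eta) / eta]. It lets the telescoping sequence [t `^ (- eta)]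
    play the part of the convergent series of the noise. *)
Lemma powRS_decrease (eta x : R) : 0 < eta -> 1 <= x ->
  eta * 2 `^ (-1 - eta) * x `^ (-1 - eta) <= x `^ (- eta) - (x + 1) `^ (- eta).
Proof.
move=> e0 x1; have x0 : 0 < x by lra.
have y0 : 0 < x + 1 by lra.
have le1 : (x + 1) `^ (- eta) * (1 + eta / (x + 1)) <= x `^ (- eta).
  have i1 : 0 < 1 - (x + 1)^-1 by rewrite subr_gt0 invf_lt1 //; lra.
  have -> : x `^ (- eta) = (x + 1) `^ (- eta) * (1 - (x + 1)^-1) `^ (- eta).
    rewrite -powRM ?(ltW y0) ?(ltW i1) //; congr (_ `^ _).
    by rewrite mulrBr mulr1 divff ?gt_eqF // addrK.
  rewrite ler_wpM2l ?powR_ge0 // /powR gt_eqF //.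
  apply: (le_trans (expR_ge1Dx _)); rewrite ler_expR mulNr -mulrN.
  by rewrite ler_wpM2l ?(ltW e0) // lerNr le_ln1Dx // ltrN2 invf_lt1 //; lra.
have le2 : 2 `^ (-1 - eta) * x `^ (-1 - eta) <= (x + 1) `^ (- eta) / (x + 1).
  have -> : (x + 1) `^ (- eta) / (x + 1) = (x + 1) `^ (-1 - eta).
    by rewrite [-1 - eta]addrC powRD ?(gt_eqF y0) ?implybT // powR_inv1 // ltW.
  rewrite -powRM ?ler0n // ?(ltW x0) //.
  have -> : -1 - eta = - (1 + eta) by rewrite opprD.
  rewrite !powRN lef_pV2 ?posrE ?powR_gt0 ?mulr_gt0 //.
  by apply: ge0_ler_powR; rewrite ?nnegrE; lra.
rewrite lerBrDr.
apply: le_trans le1; rewrite mulrDr mulr1 addrC lerD2l.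
by rewrite -mulrA [leRHS]mulrCA; apply: ler_wpM2l le2; exact: ltW.
Qed.

(** The deterministic core of the rate. Here [v], [s], [p], [q] and [beta] are the
    values at time [t] of the optimality gap, the step size, the squared norms of
    the tangential and normal parts of the gradient, and the retraction error.
    The correction [D * t `^ (- (epsilon - 2 * delta))] absorbs what the drift
    [c * s * p] does not: the normal part of the variance and [beta], which are of
    order [t `^ (2 * delta - 2)] before weighting. *)
Lemma drift_absorbs_noise (delta epsilon c lambda K0 c1 c2 Cb S : R) :
  0 < delta < 1 / 2 -> 2 * delta < epsilon < 1 ->
  0 < c -> 0 < lambda -> 0 <= K0 -> 0 <= c1 -> 0 <= c2 -> 0 <= Cb -> 0 < S ->
  exists2 D : R, 0 <= D & exists N, forall (t : nat) (v s p q beta : R),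
    (N <= t)%N -> 0 <= v -> 0 <= p -> 2 * lambda * v <= p -> q <= S ->
    t%:R `^ (delta - 1) <= S * s -> s <= S * t%:R `^ (delta - 1) ->
    beta <= Cb * t%:R `^ (2 * delta - 2) ->
    (t.+1)%:R `^ (1 - epsilon) *
        (v + K0 * s ^+ 2 * (c1 * p + c2 * q) + beta) +
      D * (t.+1)%:R `^ (- (epsilon - 2 * delta)) <=
    (t.+1)%:R `^ (1 - epsilon) * (c * s * p) +
      t%:R `^ (1 - epsilon) * v + D * t%:R `^ (- (epsilon - 2 * delta)).
Proof.
move=> /andP[d0 d1] /andP[e0 e1] c0 l0 K00 c10 c20 Cb0 S0.
pose eta := epsilon - 2 * delta; have eta0 : 0 < eta by rewrite /eta; lra.
pose E := K0 * S ^+ 2 * c2 * S + Cb.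
have E0 : 0 <= E by rewrite addr_ge0 // !mulr_ge0 // ?sqr_ge0 ?ltW.
pose C2 := eta * 2 `^ (-1 - eta).
have C20 : 0 < C2 by rewrite mulr_gt0 // powR_gt0.
exists (2 * E / C2); first by rewrite divr_ge0 ?mulr_ge0 // ltW.
(* From N1 on the variance term K0 s^2 c1 p is at most half of the drift c s p;
   from N2 on the other half beats the growth of t^(1 - epsilon). *)
have [N1 HN1] := @powR_ge_eventually (1 - delta) (2 * K0 * S * c1 / c)
  ltac:(lra).
have [N2 HN2] := @powR_ge_eventually delta (S / (c * lambda)) d0.
exists (maxn 1 (maxn N1 N2)) => t v s p q beta.
rewrite !geq_max => /and3P[t1 tN1 tN2] v0 p0 PL qS slo shi bhi.
have x1 : 1 <= t%:R :> R by rewrite ler1n.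
rewrite -[(t.+1)%:R]/(1 *+ t.+1) -natr1 -/eta; set x : R := t%:R in x1 slo shi bhi *.
have x0 : 0 < x by lra.
have xn0 : (x == 0) = false by rewrite gt_eqF.
set r := x `^ (delta - 1) in slo shi *; have r0 : 0 < r by rewrite powR_gt0.
have s0 : 0 < s by rewrite -(pmulr_rgt0 _ S0); apply: lt_le_trans slo.
have [s0' r0'] := (ltW s0, ltW r0).
have r2 : x `^ (2 * delta - 2) = r ^+ 2.
  by rewrite -powR_mulrn ?ltW // -powRrM; congr (_ `^ _); ring.
set a := x `^ (1 - epsilon); set a' := (x + 1) `^ (1 - epsilon).
have a0 : 0 < a by rewrite powR_gt0.
have a'0 : 0 < a' by rewrite powR_gt0 // addr_gt0.
have a'le : a' <= (1 + x^-1) * a by apply: powRS_le => //; lra.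
have ix1 : x^-1 <= 1 by rewrite invf_le1.
have ix0 : 0 < x^-1 by rewrite invr_gt0.
have half : 2 * (K0 * s * c1) <= c.
  have rV : r * x `^ (1 - delta) = 1.
    by rewrite -powRD ?xn0 ?implybT //; have -> : delta - 1 + (1 - delta) = 0;
      [ring | rewrite powRr0].
  have := HN1 _ tN1; rewrite -/x ler_pdivrMr // => h.
  have : 2 * K0 * S * c1 * r <= c.
    have := ler_wpM2r (ltW r0) h.
    by rewrite [leRHS]mulrAC [_ `^ _ * r]mulrC rV mul1r.
  apply: le_trans.
  have := ler_wpM2l (mulr_ge0 (mulr_ge0 (ler0n _ 2) K00) c10) shi.
  by lra.
have drift : (1 + x^-1) * (1 - c * lambda * s) <= 1.
  have : x^-1 <= c * lambda * s.
    have rx : r = x^-1 * x `^ delta.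
      by rewrite /r addrC powRD ?xn0 ?implybT // powR_inv1 // ltW.
    have := HN2 _ tN2; rewrite -/x ler_pdivrMr ?mulr_gt0 // => h.
    have : S * x^-1 <= x^-1 * x `^ delta * (c * lambda).
      by rewrite mulrC -mulrA ler_wpM2l // ltW.
    rewrite -rx => h2; rewrite -(ler_pM2l S0) (le_trans h2) //.
    rewrite mulrC [leRHS]mulrCA ler_wpM2l // ltW // mulr_gt0 //.
  nra.
have noise : a' * (K0 * s ^+ 2 * (c2 * q) + beta) <=
    2 * E / C2 * x `^ (- eta) - 2 * E / C2 * (x + 1) `^ (- eta).
  have s2 : s ^+ 2 <= S ^+ 2 * r ^+ 2.
    by rewrite -exprMn ler_sqr ?nnegrE ?mulr_ge0 // ltW.
  have : K0 * s ^+ 2 * (c2 * q) + beta <= E * r ^+ 2.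
    rewrite r2 in bhi; rewrite /E mulrDl lerD //.
    have -> : K0 * S ^+ 2 * c2 * S * r ^+ 2 =
      (K0 * (S ^+ 2 * r ^+ 2)) * (c2 * S) by ring.
    apply: (@le_trans _ _ (K0 * s ^+ 2 * (c2 * S))).
      by rewrite ler_wpM2l ?mulr_ge0 ?sqr_ge0 // ler_wpM2l.
    by rewrite ler_wpM2r ?mulr_ge0 ?(ltW S0) // ler_wpM2l.
  move=> h.
  have ar : a * r ^+ 2 = x `^ (-1 - eta).
    rewrite -r2 -powRD ?xn0 ?implybT //; congr (_ `^ _); rewrite /eta; ring.
  apply: (@le_trans _ _ (2 * a * (E * r ^+ 2))).
    apply: (le_trans (ler_wpM2l (ltW a'0) h)).
    rewrite ler_wpM2r ?mulr_ge0 ?sqr_ge0 //.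
    by apply: (le_trans a'le); rewrite ler_wpM2r ?(ltW a0) //; lra.
  have -> : 2 * a * (E * r ^+ 2) = 2 * E / C2 * (C2 * x `^ (-1 - eta)).
    by rewrite -ar; field; rewrite gt_eqF.
  rewrite -mulrBr ler_wpM2l ?(divr_ge0 _ (ltW C20)) ?mulr_ge0 //.
  exact: powRS_decrease.
have drift_v : a' * (v - c * lambda * s * v) <= a * v.
  have [neg|pos] := leP (1 - c * lambda * s) 0.
    apply: (@le_trans _ _ 0); last by rewrite mulr_ge0 // ltW.
    by rewrite pmulr_rle0 // -[X in X - _]mul1r -mulrBl mulr_le0_ge0.
  rewrite -[X in X - _]mul1r -mulrBl mulrA ler_wpM2r //.
  apply: (le_trans (ler_wpM2r (ltW pos) a'le)).
  by rewrite mulrAC -[leRHS]mul1r ler_wpM2r // ltW.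
have half_p : K0 * s ^+ 2 * (c1 * p) <= c * s * p / 2.
  have := ler_wpM2r (mulr_ge0 (ltW s0) p0) half; lra.
have PL_p : c * lambda * s * v <= c * s * p / 2.
  have := ler_wpM2l (mulr_ge0 (ltW c0) (ltW s0)) PL; lra.
have main : a' * (v + K0 * s ^+ 2 * (c1 * p + c2 * q) + beta) <=
    a' * (c * s * p) + a * v + a' * (K0 * s ^+ 2 * (c2 * q) + beta).
  rewrite -lerBlDr -mulrBr.
  have le1 : v + K0 * s ^+ 2 * (c1 * p + c2 * q) + beta -
      (K0 * s ^+ 2 * (c2 * q) + beta) <= c * s * p + (v - c * lambda * s * v).
    by move: half_p PL_p; set X := c * s * p; set Y := c * lambda * s * v; lra.
  by apply: (le_trans (ler_wpM2l (ltW a'0) le1)); rewrite mulrDr lerD2l.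
by move: main noise; lra.
Qed.

End powers.

(** * The almost sure rate *)

Section local_rate.
Context (R : realType) (H : completeNormedModType R) (dot : H -> H -> R)
  (hdot : inner_product dot) (M : set H) (Loss : H -> R)
  (hinf : has_lbound (Loss @` M)) (grad : H -> H)
  (hgrad : forall v, M v -> riesz_gradient dot Loss v (grad v))
  (d : measure_display) (Omega : measurableType d) (Pr : probability Omega R)
  (F : nat -> set (set Omega)) (hF : filtration F)
  (u : nat -> Omega -> H)
  (hu_meas : forall t, sub_measurable (F t) (u t : Omega -> borel H))
  (hg_meas : forall t,
      sub_measurable (F t) ((grad \o u t) : Omega -> borel H))
  (hu : forall t w, M (u t w))
  (assoc : H -> set H -> Prop)
  (T : nat -> Omega -> set H) (hassoc : forall t w, assoc (u t w) (T t w))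
  (dimT : nat -> Omega -> nat) (hdim : forall t w, has_dim (T t w) (dimT t w))
  (P : nat -> Omega -> H -> H)
  (hP : forall t w, orth_proj dot (T t w) (P t w))
  (hP_meas : forall t (g : Omega -> borel H), sub_measurable (F t) g ->
      sub_measurable (F t) ((fun w => P t w (g w)) : Omega -> borel H))
  (Pn : nat -> Omega -> H -> H)
  (hPn : forall t w h, T t w (Pn t w h))
  (s : nat -> Omega -> R) (hs_pos : forall t w, 0 < s t w)
  (hs_meas : forall t, sub_measurable (F t) (s t))
  (Ret : nat -> Omega -> H -> H) (hRet : forall t w h, M (Ret t w h))
  (hstep : forall t w,
      u t.+1 w = Ret t w (u t w - s t w *: Pn t w (grad (u t w))))
  (Lc lambda C_R c_bias1 c_var1 c_var2 : R) (beta : nat -> R)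
  (hLc : 0 < Lc) (hlambda : 0 < lambda) (hC_R : 0 < C_R)
  (hbeta : forall t, 0 <= beta t)
  (hc_bias1 : 0 < c_bias1) (hc_var1 : 0 < c_var1) (hc_var2 : 0 < c_var2)
  (hsmooth : restricted_smooth dot M assoc Loss grad Lc)
  (hPL : strong_PL dot M assoc Loss grad lambda)
  (hretr : controlled_retraction Loss u T Ret C_R beta)
  (hbias : bounded_bias dot Pr F P Pn c_bias1)
  (hvar : bounded_variance Pr F P Pn c_var1 c_var2)
  (delta : R) (hdelta : 0 < delta < 1 / 2)
  (epsilon : R) (hepsilon : 2 * delta < epsilon < 1).

Let gap t w := Loss (u t w) - inf (Loss @` M).
Let g t w := grad (u t w).
Let p t w := `|P t w (g t w)| ^+ 2.
Let q t w := `|g t w - P t w (g t w)| ^+ 2.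
Let K0 := (Lc + C_R) / 2.

(** The localizing condition at time [t]: the almost sure bounds, whose constants
    depend on the outcome, hold with the single constant [S]. *)
Definition tame (S : R) t w :=
  [/\ t%:R `^ (delta - 1) <= S * s t w, s t w <= S * t%:R `^ (delta - 1)
    & q t w <= S].

Lemma gap_ge0 t w : 0 <= gap t w.
Proof. by rewrite subr_ge0; apply: ge_inf => //; exists (u t w). Qed.

Lemma sub_measurable_gap t : sub_measurable (F t) (gap t).
Proof.
apply: measurable_funB => //.
apply: (@sub_measurable_comp_continuous _ _ _ _ _ M) => // x Mx.
by have [df _] := hgrad Mx; exact: differentiable_continuous.
Qed.

Lemma sub_measurable_p t : sub_measurable (F t) (p t).
Proof. by apply: sub_measurable_normsq; apply: hP_meas; exact: hg_meas. Qed.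

(** Borel functions into a nonseparable space need not be closed under subtraction;
    Pythagoras reduces the norm of the difference to norms of its terms. *)
Lemma sub_measurable_q t : sub_measurable (F t) (q t).
Proof.
have -> : q t = (fun w => `|g t w| ^+ 2 - p t w).
  apply/funext => w; rewrite (orth_proj_pythagoras hdot (g t w) (hP t w)).
  by rewrite [X in _ = X - _]addrC addrK.
apply: measurable_funB; last exact: sub_measurable_p.
by apply: sub_measurable_normsq; exact: hg_meas.
Qed.

Lemma gap_descent t w : gap t.+1 w <=
  gap t w - s t w * dot (g t w) (Pn t w (g t w)) +
    K0 * s t w ^+ 2 * `|Pn t w (g t w)| ^+ 2 + beta t.
Proof.
have := descent hdot (hu t w) (hassoc t w) (hdim t w) hsmooth (@hretr t w)
  (s t w) (hPn t w (g t w)).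
by rewrite -hstep /gap /K0 /g; lra.
Qed.

Lemma p_le t w : p t w <= 2 * (Lc + C_R) * (gap t w + beta t).
Proof.
exact: (proj_gradient_le hdot (hu t w) (hassoc t w) (hdim t w) hsmooth
  (@hretr t w) (hP t w) (addr_gt0 hLc hC_R) hinf (hRet t w)).
Qed.

(** With the constants fixed at [S] and [Cb], the weighted gap plus the correction
    of [drift_absorbs_noise] is a local supermartingale from some time on. That
    time depends on the constants only, so the localization may start at any later
    time [N]. *)
Lemma local_rate (S Cb : R) : 0 < S -> 0 <= Cb -> exists N0, forall N,
  (N0 <= N)%N ->
  (forall t, (N <= t)%N -> beta t <= Cb * t%:R `^ (2 * delta - 2)) ->
  {ae Pr, forall w, (forall t, (N <= t)%N -> tame S t w) ->
    exists m, forall t, (N <= t)%N -> t%:R `^ (1 - epsilon) * gap t w <= m}.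
Proof.
move=> S0 Cb0.
have /andP[e_gt e_lt] := hepsilon.
have K00 : 0 <= K0 by rewrite divr_ge0 // addr_ge0 // ltW.
have [D D0 [N1 HN1]] := drift_absorbs_noise hdelta hepsilon hc_bias1 hlambda K00
  (ltW hc_var1) (ltW hc_var2) Cb0 S0.
exists (maxn 1 N1) => N; rewrite geq_max => /andP[N_gt0 N1N] hbN.
have [sF FM Fle] := hF.
pose b t : R := D * t%:R `^ (- (epsilon - 2 * delta)).
pose W t w := t%:R `^ (1 - epsilon) * gap t w + b t.
have b0 t : 0 <= b t by rewrite mulr_ge0 // powR_ge0.
have gap0 := gap_ge0.
have W0 t w : 0 <= W t w by rewrite addr_ge0 // mulr_ge0 // powR_ge0.
have mW t : sub_measurable (F t) (W t).
  by apply: measurable_funD => //; apply: measurable_funM => //;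
    exact: sub_measurable_gap.
have hF' : filtration (fun k => F (N + k)%N).
  by split => k; rewrite ?addnS.
have FA k : F (N + k)%N [set w | tame S (N + k) w].
  set t := (N + k)%N; set r := t%:R `^ (delta - 1).
  have -> : [set w | tame S t w] =
      s t @^-1` `[r / S, S * r] `&` q t @^-1` `]-oo, S].
    apply/seteqP; split => w; rewrite /= !in_itv /= ler_pdivrMr // mulrC.
      by case=> -> -> ->.
    by case=> /andP[? ?] ?; split.
  apply: sigma_algebra_setI => //; apply: sub_measurable_preimage => //.
  exact: sub_measurable_q.
have step k B (m : R) : F (N + k)%N B -> B `<=` [set w | tame S (N + k) w] ->
    (forall w, B w -> W (N + k)%N w <= m) ->
    (\int[Pr]_(w in B) (W (N + k.+1)%N w)%:E
      <= \int[Pr]_(w in B) (W (N + k)%N w)%:E)%E.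
  set t := (N + k)%N; rewrite addnS -/t => GB BA Wm.
  have t_ge : (N <= t)%N by rewrite leq_addr.
  have t_gt0 : 0 < t%:R :> R by rewrite ltr0n (leq_trans N_gt0).
  pose a := t%:R `^ (1 - epsilon); pose a' := (t.+1)%:R `^ (1 - epsilon).
  have a0 : 0 < a by rewrite powR_gt0.
  have a'0 : 0 < a' by rewrite powR_gt0.
  (* if the next gap is at most U in the mean, then the mean of W does not grow *)
  pose U w := (W t w - b t.+1) / a'.
  have WE w : W t w = a' * U w + b t.+1.
    by rewrite mulrC divfK ?gt_eqF // subrK.
  have [eX [cX leX]] := hbias (@hg_meas t).
  have [eY [cY leY]] := hvar (@hg_meas t).
  have b_le : b t.+1 <= b t.
    rewrite ler_wpM2l // !powRN lef_pV2 ?posrE ?powR_gt0 //.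
    by apply: ge0_ler_powR; rewrite ?nnegrE ?ler_nat //; lra.
  have U0 w : 0 <= U w.
    rewrite divr_ge0 ?(ltW a'0) // subr_ge0 (le_trans b_le) //.
    by rewrite lerDr mulr_ge0 // ltW.
  have gap_le w : B w -> gap t w <= m / a.
    move=> /Wm Wle; rewrite ler_pdivlMr // mulrC (le_trans _ Wle) //.
    by rewrite lerDl.
  have mB := FM _ _ GB.
  have mT (f : Omega -> R) : sub_measurable (F t) f -> measurable_fun setT f.
    exact: sub_measurableW (sF t) (FM t).
  have mgap' : measurable_fun setT (gap t.+1).
    exact: sub_measurableW (sF _) (FM _) (@sub_measurable_gap t.+1).
  have mU : measurable_fun setT U.
    apply: measurable_funM => //; apply: measurable_funB => //; exact: mT.
  (* the last argument of the maximum bounds p, through [p_le] *)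
  pose m' := Num.max (Num.max (S * t%:R `^ (delta - 1)) S)
    (2 * (Lc + C_R) * (m / a + beta t)).
  have intU : (\int[Pr]_(w in B) (gap t.+1 w)%:E
      <= \int[Pr]_(w in B) (U w)%:E)%E.
    apply: (@integrated_descent _ _ _ Pr (F t) (sF t) (FM t) (gap t) _ _ _ (s t)
      (p t) (q t) U eX eY c_bias1 K0 c_var1 c_var2 (beta t) m' B) cX leX cY leY
      _ _ GB _ _ => //.
    - by move=> w; exact: ltW.
    - by move=> w; exact: sqr_ge0.
    - by move=> w; exact: sqr_ge0.
    - exact: ltW.
    - exact: ltW.
    - exact: ltW.
    - exact: sub_measurable_gap.
    - exact: sub_measurable_p.
    - exact: sub_measurable_q.
    - by move=> w; exact: gap_descent.
    - move=> w; rewrite (orth_proj_dot hdot (g t w) (hP t w) (hPn t w _)).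
      exact: dotN_le.
    - move=> w Bw; have [_ sle qle] := BA w Bw; split.
      + by rewrite /m' !le_max sle.
      + rewrite /m' le_max; apply/orP; right; apply: (le_trans (p_le t w)).
        rewrite ler_wpM2l ?mulr_ge0 ?addr_ge0 ?(ltW hLc) ?(ltW hC_R) //.
        by rewrite lerD2r gap_le.
      + by rewrite /m' !le_max qle orbT.
    - move=> w Bw; have [slo shi qle] := BA w Bw.
      have PL := hPL (hu t w) (hassoc t w) (hP t w).
      have := HN1 t (gap t w) (s t w) (p t w) (q t w) (beta t)
        (leq_trans N1N t_ge) (gap0 t w) (sqr_ge0 _) PL qle slo shi (hbN t t_ge).
      rewrite -/a -/a' -[_ + D * _ in leRHS]addrA -/(b t) -/(W t w) WE -/(b t.+1).
      rewrite addrA lerD2r -mulrDr ler_pM2l //.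
  have intE (f : Omega -> R) : measurable_fun setT f -> (forall w, 0 <= f w) ->
      (\int[Pr]_(w in B) (a' * f w + b t.+1)%:E =
        a'%:E * \int[Pr]_(w in B) (f w)%:E + (b t.+1)%:E * Pr B)%E.
    move=> mf f0.
    have mfB : measurable_fun B (EFin \o f).
      by apply: measurable_funTS; exact/measurable_EFinP.
    under eq_integral do rewrite EFinD EFinM.
    rewrite ge0_integralD //; first last.
    - by move=> w _; rewrite lee_fin.
    - by apply: measurable_funeM.
    - by move=> w _; rewrite -EFinM lee_fin mulr_ge0 // ltW.
    rewrite ge0_integralZl_EFin ?(ltW a'0) //; last by move=> w _; rewrite lee_fin.
    by rewrite integral_cst.
  under [leRHS]eq_integral do rewrite WE.
  rewrite /W -/a' !intE // leeD2r // lee_wpmul2l // lee_fin ltW //.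
have := local_supermartingale_bounded (Pr := Pr) hF' (fun k => W0 (N + k)%N)
  (fun k => mW (N + k)%N) FA step.
apply: filterS => w Hw Aw.
have [k|m Hm] := Hw; first by apply: Aw; rewrite leq_addr.
exists m => t Nt; rewrite -(subnKC Nt).
by apply: le_trans (Hm (t - N)%N); rewrite lerDl.
Qed.

End local_rate.

Lemma bigO_seqP (R : realType) (f h : nat -> R^o) :
  f =O_\oo h <-> exists2 k : R, 0 < k &
    exists N, forall t, (N <= t)%N -> `|f t| <= k * `|h t|.
Proof.
rewrite eqO_exP; split => -[k k0].
  by move=> [N _ HN]; exists k => //; exists N => t; exact: HN.
by move=> [N HN]; exists k => //; exists N => // t; exact: HN.
Qed.

Theorem corollary4p13 (R : realType)
  (H : completeNormedModType R) (dot : H -> H -> R)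
  (hdot : inner_product dot) (M : set H)
  (dX : measure_display) (X : measurableType dX) (rho : probability X R)
  (ell : H -> X -> R)
  (hell : forall v, rho.-integrable setT (EFin \o ell v))
  (Loss : H -> R)
  (hLoss : forall v, Loss v = \int[rho]_x ell v x)
  (hinf : has_lbound (Loss @` M))
  (grad : H -> H)
  (hgrad : forall v, M v -> riesz_gradient dot Loss v (grad v))
  (d : measure_display) (Omega : measurableType d) (Pr : probability Omega R)
  (F : nat -> set (set Omega)) (hF : filtration F)
  (u : nat -> Omega -> H)
  (hu_meas : forall t, sub_measurable (F t) (u t : Omega -> borel H))
  (hg_meas : forall t,
      sub_measurable (F t) ((grad \o u t) : Omega -> borel H))
  (hu0 : forall w, M (u 0%N w))
  (assoc : H -> set H -> Prop)
  (T : nat -> Omega -> set H) (hassoc : forall t w, assoc (u t w) (T t w))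
  (dimT : nat -> Omega -> nat) (hdim : forall t w, has_dim (T t w) (dimT t w))
  (P : nat -> Omega -> H -> H)
  (hP : forall t w, orth_proj dot (T t w) (P t w))
  (hP_meas : forall t (g : Omega -> borel H), sub_measurable (F t) g ->
      sub_measurable (F t) ((fun w => P t w (g w)) : Omega -> borel H))
  (n : nat)
  (mu : forall t, R.-pker (g_sigma_algebraType (F t)) ~> X)
  (xs : nat -> Omega -> n.-tuple X)
  (hxs : forall t, cond_iid Pr (xs t) (mu t))
  (est : nat -> Omega -> n.-tuple X -> H -> H)
  (hest_meas : forall t (g : Omega -> borel H), sub_measurable (F t) g ->
      measurable_fun setT
        ((fun z => est t z.1 z.2 (g z.1))
         : g_sigma_algebraType (F t) * n.-tuple X -> borel H))
  (hest : forall t w x h, T t w (est t w x h))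
  (Pn : nat -> Omega -> H -> H)
  (hPn : forall t w h, Pn t w h = est t w (xs t w) h)
  (s : nat -> Omega -> R) (hs_pos : forall t w, 0 < s t w)
  (hs_meas : forall t, sub_measurable (F t) (s t))
  (Ret : nat -> Omega -> H -> H) (hRet : forall t w h, M (Ret t w h))
  (hRet_meas : forall t h,
      sub_measurable (F t) ((fun w => Ret t w h) : Omega -> borel H))
  (hstep : forall t w,
      u t.+1 w = Ret t w (u t w - s t w *: Pn t w (grad (u t w))))
  (Lc lambda C_R c_bias1 c_var1 c_var2 : R) (beta : nat -> R)
  (hLc : 0 < Lc) (hlambda : 0 < lambda) (hC_R : 0 < C_R)
  (hbeta : forall t, 0 <= beta t)
  (hc_bias1 : 0 < c_bias1) (hc_var1 : 0 < c_var1) (hc_var2 : 0 < c_var2)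
  (hsmooth : restricted_smooth dot M assoc Loss grad Lc)
  (hPL : strong_PL dot M assoc Loss grad lambda)
  (hretr : controlled_retraction Loss u T Ret C_R beta)
  (hbias : bounded_bias dot Pr F P Pn c_bias1)
  (hvar : bounded_variance Pr F P Pn c_var1 c_var2)
  (delta : R) (hdelta : 0 < delta < 1 / 2)
  (hs_upper : {ae Pr, forall w,
      ((fun t => s t w) : nat -> R^o)
        =O_\oo ((fun t => t%:R `^ (delta - 1)) : nat -> R^o)})
  (* s_t has exact order t^(delta - 1); with the upper bound alone, summable
     step sizes would be allowed and the conclusion would be false *)
  (hs_lower : {ae Pr, forall w,
      ((fun t => t%:R `^ (delta - 1)) : nat -> R^o)
        =O_\oo ((fun t => s t w) : nat -> R^o)})
  (hbeta_upper : (beta : nat -> R^o)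
        =O_\oo ((fun t => t%:R `^ (2 * delta - 2)) : nat -> R^o))
  (hperp : {ae Pr, forall w,
      bounded_fun ((fun t => `|grad (u t w) - P t w (grad (u t w))|)
                   : nat -> R^o)})
  (epsilon : R) (hepsilon : 2 * delta < epsilon < 1) :
  {ae Pr, forall w,
    ((fun t => Loss (u t w) - inf (Loss @` M)) : nat -> R^o)
      =O_\oo ((fun t => t%:R `^ (-1 + epsilon)) : nat -> R^o)}.
Proof.
have hu t w : M (u t w) by case: t => [|t]; rewrite ?hstep.
have hPnT t w h : T t w (Pn t w h) by rewrite hPn; exact: hest.
have [Cb Cb0 [Tb HTb]] := (bigO_seqP _ _).1 hbeta_upper.
have hb t : (Tb <= t)%N -> beta t <= Cb * t%:R `^ (2 * delta - 2).
  move=> /HTb; rewrite [X in _ * X]ger0_norm ?powR_ge0 //.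
  exact: (le_trans (ler_norm _)).
have rate : {ae Pr, forall w, forall K : nat, exists N0, forall i,
    (forall t, (N0 + i <= t)%N -> tame grad u P s delta K.+1%:R t w) ->
    exists m, forall t, (N0 + i <= t)%N ->
      t%:R `^ (1 - epsilon) * (Loss (u t w) - inf (Loss @` M)) <= m}.
  apply: ae_foralln => K.
  have [N0 HN0] := local_rate hdot hinf hgrad hF hu_meas hg_meas hu hassoc hdim
    hP hP_meas hPnT hs_pos hs_meas hRet hstep hLc hlambda hC_R hbeta hc_bias1
    hc_var1 hc_var2 hsmooth hPL hretr hbias hvar hdelta hepsilon
    (ltr0Sn R K) (ltW Cb0).
  suff : {ae Pr, forall w, forall i,
      (forall t, (N0 + Tb + i <= t)%N -> tame grad u P s delta K.+1%:R t w) ->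
      exists m, forall t, (N0 + Tb + i <= t)%N ->
        t%:R `^ (1 - epsilon) * (Loss (u t w) - inf (Loss @` M)) <= m}.
    by apply: filterS => w Hw; exists (N0 + Tb)%N.
  apply: ae_foralln => i; apply: HN0; first by rewrite -addnA leq_addr.
  move=> t le_t; apply: hb; apply: leq_trans le_t.
  by rewrite -addnA addnCA leq_addr.
have tameE : {ae Pr, forall w, exists K T0 : nat,
    forall t, (T0 <= t)%N -> tame grad u P s delta K.+1%:R t w}.
  move: hs_upper hs_lower hperp; apply: filterS3 => w.
  move=> /bigO_seqP[k1 k10 [T1 H1]] /bigO_seqP[k2 k20 [T2 H2]].
  move=> [B0 [_ HB]].
  pose k3 := (B0 + 1) ^+ 2.
  pose K := Num.truncn (Num.max k1 (Num.max k2 k3)).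
  have Kge : Num.max k1 (Num.max k2 k3) <= K.+1%:R by exact/ltW/truncnS_gt.
  move: Kge; rewrite !ge_max => /and3P[k1K k2K k3K].
  exists K, (maxn T1 T2) => t; rewrite geq_max => /andP[/H1 t1 /H2 t2].
  rewrite [X in X <= _]gtr0_norm // ger0_norm ?powR_ge0 // in t1.
  rewrite [X in _ * X]gtr0_norm // ger0_norm ?powR_ge0 // in t2.
  split.
  - by apply: (le_trans t2); rewrite ler_wpM2r // ltW.
  - by apply: (le_trans t1); rewrite ler_wpM2r // powR_ge0.
  - apply: le_trans k3K; rewrite /k3.
    have h := HB (B0 + 1) (ltr_pwDr ltr01 (lexx _)) t I.
    by rewrite /= normr_id in h; rewrite ler_pXn2r ?nnegrE // (le_trans _ h).
move: rate tameE; apply: filterS2 => w Hw [K [T0 HK]].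
have [N0 HN0] := Hw K.
have [t le_t|m Hm] := HN0 T0.
  by apply: HK; apply: leq_trans le_t; exact: leq_addl.
apply/bigO_seqP; exists (`|m| + 1); first by rewrite ltr_wpDl.
exists (maxn 1 (N0 + T0)) => t; rewrite geq_max => /andP[t_gt0 /Hm le_m].
have gap0 : 0 <= Loss (u t w) - inf (Loss @` M).
  by rewrite subr_ge0; apply: ge_inf => //; exists (u t w).
have : Loss (u t w) - inf (Loss @` M) <= (`|m| + 1) / t%:R `^ (1 - epsilon).
  rewrite ler_pdivlMr ?powR_gt0 ?ltr0n // mulrC (le_trans le_m) //.
  by rewrite (le_trans (ler_norm _)) // lerDl.
rewrite (ger0_norm gap0) (ger0_norm (powR_ge0 _ _)) -powRN opprB.
by rewrite [-1 + epsilon]addrC.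
Qed.
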